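(* For $N\in\mathbb{Z}^+$ let $V(N)$ denote the number of positive integers $n\le N$ such that $4n+1$ and $4n+3$ are both prime, and let $$\mathfrak{S}=\prod_{p>2}\Big(1-\frac{1}{(p-1)^2}\Big),$$ where $p$ runs over all odd primes. Assume that $$V(N)=4\mathfrak{S}\,\frac{N}{\log^2 N}\,\big(1+o(1)\big)\quad\text{as } N\to+\infty.$$ Then there are infinitely many primes in the set $\mathcal{A}_4=\{\pi(4k):\ k\in\mathbb{Z}^+\}$.
   Context: $\mathbb{Z}^+=\{1,2,3,\ldots\}$. For $x\ge 0$, $\pi(x)$ denotes the number of primes not exceeding $x$. $\log$ is the natural logarithm and $\log^2 N=(\log N)^2$. The assumed asymptotic formula for $V(N)$ is a case of the (unproved) Bateman--Horn conjecture and is a hypothesis of the theorem. *)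

(* Defs.v *)
From mathcomp Require Import all_boot all_order all_algebra.
From mathcomp Require Import all_classical all_reals all_analysis.

Set Implicit Arguments.
Unset Strict Implicit.
Unset Printing Implicit Defensive.

Import Order.TTheory GRing.Theory Num.Theory.
Import numFieldNormedType.Exports.

Local Open Scope classical_set_scope.

(* The argument of pi ranges over nat: only the values pi(4k) are used. *)
Definition primepi (x : nat) : nat := count prime (iota 0 x.+1).

Definition A4 : set nat :=
  [set m | exists2 k : nat, (0 < k)%N & m = primepi (4 * k)].

Definition V (N : nat) : nat :=
  count (fun n => prime (4 * n + 1) && prime (4 * n + 3)) (iota 1 N).

Local Open Scope ring_scope.

(* The partial products are nonincreasing and nonnegative, so the limit exists
   and [limn] does not return a junk value. *)
Definition singular_series (R : realType) : R :=
  limn (fun n : nat =>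
    \prod_(0 <= p < n | prime p && (2 < p)%N) (1 - 1 / (p%:R - 1) ^+ 2) : R).

(* Main.v *)
Require Import Defs.
From mathcomp Require Import all_boot all_order all_algebra.
From mathcomp Require Import all_classical all_reals all_analysis.
From mathcomp Require Import zify ring lra.

Import Order.TTheory GRing.Theory Num.Theory.
Import numFieldNormedType.Exports.

(** Passing from [4n] to [4n+4], the prime counting function pi gains at most
    two primes, namely [4n+1] and [4n+3]. Hence it jumps over a value only when
    these two numbers are both prime, so that each value missing from [A4] is
    paid for by one pair counted by [V]. If [A4] contained only finitely many
    primes, almost every prime would be a missing value, and the number
    pi(pi(4N)) of primes up to pi(4N) would be at most V(N) + O(1)
    ([primepi_primepi_le]).

    The prime number theorem would give pi(pi(4N)) ~ 4N/log^2 N, whereas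
    V(N) ~ 4 S N/log^2 N with S < 1: a contradiction. Since S is well below 1,
    the prime number theorem can be replaced by a lower bound
    pi(x) >= c x/log x for any c with c^2 > S. The first two factors of the
    Euler product give S <= 45/64 ([singular_series_le]), so that any
    c > 0.8386 will do. The bound from central binomial coefficients has
    c = log 2 = 0.693..., which is too small. Chebyshev's quotient
    (30n)! n! / ((15n)! (10n)! (6n)!) reaches c = 0.921...; rough estimates of
    log 2, log 3 and log 5 keep every c < 7/8 of it ([chebyshev_lower]), and
    c = 0.87 is used at the end. *)

(** * The values of [primepi] missed by [A4] *)

Lemma primepiS n : primepi n.+1 = (primepi n + prime n.+1)%N.
Proof. by rewrite /primepi -(addn1 n.+1) iotaD count_cat /= addn0. Qed.

Lemma leq_primepi m n : (m <= n)%N -> (primepi m <= primepi n)%N.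
Proof.
move=> /subnKC <-; elim: (n - m)%N => [|k IH]; first by rewrite addn0.
by rewrite addnS primepiS (leq_trans IH) ?leq_addr.
Qed.

Lemma primepi_leq n : (primepi n <= n)%N.
Proof. by elim: n => // n IH; rewrite primepiS; case: prime; lia. Qed.

Lemma VS n : V n.+1 = (V n + (prime (4 * n.+1 + 1) && prime (4 * n.+1 + 3)))%N.
Proof. by rewrite /V -[in LHS](addn1 n) iotaD count_cat /= addn0 add1n. Qed.

Lemma prime_even n : (1 < n)%N -> prime (2 * n) = false.
Proof.
move=> n1; apply/negbTE/primePn; right; exists 2; last exact: dvdn_mulr.
by lia.
Qed.

Lemma primepi_mul4S n : (0 < n)%N ->
  primepi (4 * n.+1) =
  (primepi (4 * n) + prime (4 * n + 1) + prime (4 * n + 3))%N.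
Proof.
move=> n0; have -> : (4 * n.+1 = (4 * n).+4)%N by lia.
rewrite 4!primepiS.
have p2 : prime (4 * n).+2 = false.
  by rewrite (_ : (4 * n).+2 = 2 * (2 * n).+1)%N ?prime_even //; lia.
have p4 : prime (4 * n).+4 = false.
  by rewrite (_ : (4 * n).+4 = 2 * (2 * n).+2)%N ?prime_even //; lia.
by rewrite p2 p4 !addn0 addn1 addn3.
Qed.

(** By induction on [n]: the step from [4n] to [4n+4] increases the left-hand
    side only if [primepi] takes a prime value there. The final value
    [primepi (4n+4)] lies in [A4] and so is not a prime beyond [B]; a prime can
    only be the intermediate value of a double step, and then [4n+1] and [4n+3]
    are both prime and [V] grows as well. Such a pair belongs to the step that
    starts at [4n], so only those starting below [4n] count: hence [n.-1]. *)
Lemma primepi_primepi_le B :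
  (forall q, A4 q -> prime q -> q <= B)%N ->
  forall n, (primepi (primepi (4 * n)) <= V n.-1 + maxn B 2)%N.
Proof.
move=> hB; elim=> [|n IH]; first by rewrite muln0.
(* The step from 0 to 4 is special, because of the even prime 2. *)
have [n0|n0] := posnP n.
  by subst n; apply: (@leq_trans 1); rewrite ?leq_addl //; lia.
set m' := primepi (4 * n.+1).
have [m'B|Bm'] := leqP m' B.
  by apply: (leq_trans (primepi_leq _)); lia.
have m'Nprime : prime m' = false.
  apply/negP => pm'; have : (m' <= B)%N by apply: hB => //; exists n.+1.
  by lia.
have VE : V n = (V n.-1 + (prime (4 * n + 1) && prime (4 * n + 3)))%N.
  by rewrite -[in LHS](prednK n0) VS (prednK n0).
move: m'Nprime IH; rewrite /m' primepi_mul4S //= VE.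
case: (prime (4 * n + 1)); case: (prime (4 * n + 3)); rewrite /= ?addn0 ?addn1.
(* Only a double step can pass through a prime value, at its midpoint. *)
- move=> pf; rewrite !primepiS pf addn0.
  by case: prime; lia.
- by move=> pf; rewrite primepiS pf addn0.
- by move=> pf; rewrite primepiS pf addn0.
- by [].
Qed.

(** * Chebyshev's quotient of factorials *)

(** Legendre's formula with a common range of summation, so that the
    factorials of the quotient can be compared term by term. *)
Lemma logn_fact_widen p n m : prime p -> (n <= m)%N ->
  logn p n`! = (\sum_(1 <= k < m.+1) n %/ p ^ k)%N.
Proof.
move=> pp nm; rewrite logn_fact // (@big_cat_nat _ _ _ n.+1 1 m.+1) //=.
rewrite [X in (_ + X)%N]big_nat [X in (_ + X)%N]big1 ?addn0 // => k /andP[nk _].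
rewrite divn_small // (leq_trans nk) // ltnW //.
exact/ltn_expl/prime_gt1.
Qed.

(** The identity 30 + 1 = 15 + 10 + 6 makes the difference of the two sums
    of quotients depend only on the residue of [n] modulo [d], that is on
    t = floor(30 (n mod d)/d) < 30, and the inequality becomes
    t <= floor(t/2) + floor(t/3) + floor(t/5) + 1, a finite check. The quotients
    all vanish for [30 n < d], whence the last term. *)
Lemma chebyshev_floor n d : (0 < d)%N ->
  (30 * n %/ d + n %/ d <=
   15 * n %/ d + 10 * n %/ d + 6 * n %/ d + (d <= 30 * n))%N.
Proof.
move=> d0; have [dn|nd] := leqP d (30 * n); last first.
  by rewrite !divn_small //; lia.
have H k : (k * n %/ d = k * (n %/ d) + k * (n %% d) %/ d)%N.
  by rewrite {1}(divn_eq n d) mulnDr mulnA divnMDl.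
have D k j : (0 < k)%N -> (j * (n %% d) %/ d = k * j * (n %% d) %/ d %/ k)%N.
  by move=> k0; rewrite -divnMA (mulnC d) -mulnA divnMl.
rewrite (H 30) (H 15) (H 10) (H 6).
rewrite (D 2%N 15%N) // (D 3%N 10%N) // (D 5%N 6%N) //.
have : (30 * (n %% d) %/ d < 30)%N.
  by rewrite ltn_divLR // ltn_pmul2l // ltn_mod.
by move: (30 * (n %% d) %/ d)%N (n %/ d)%N => t q; lia.
Qed.

Lemma prod_logn a m : (0 < a)%N ->
  (forall p, prime p -> p %| a -> p <= m)%N ->
  a = (\prod_(0 <= p < m.+1 | prime p) p ^ logn p a)%N.
Proof.
move=> a0 am; rewrite -{1}(@part_pnat_id [pred p | prime p] a); last first.
  by rewrite /pnat a0; apply/allP => p; rewrite mem_primes => /andP[].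
rewrite (@widen_partn (maxn a m)) ?leq_maxl //.
rewrite (@big_cat_nat _ _ _ m.+1 0 (maxn a m).+1) //=; last first.
  by rewrite ltnS leq_maxr.
rewrite [X in (_ * X)%N]big_nat_cond [X in (_ * X)%N]big1 ?muln1 //.
move=> p /andP[/andP[mp _] pp].
rewrite -(expn0 p); congr (_ ^ _)%N; apply/eqP; rewrite -leqn0 leqNgt logn_gt0.
by rewrite mem_primes; apply/negP => /and3P[_ _ /(am _ pp)]; rewrite leqNgt mp.
Qed.

Lemma prime_dvd_fact p n : prime p -> (p %| n`!)%N -> (p <= n)%N.
Proof.
move=> pp; elim: n => [|n IH].
  by rewrite dvdn1 => /eqP p1; move: pp; rewrite p1.
by rewrite factS Euclid_dvdM // => /orP[/dvdn_leq->//|/IH/leqW].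
Qed.

Lemma prod_primepi m c : (\prod_(0 <= p < m.+1 | prime p) c = c ^ primepi m)%N.
Proof. by rewrite big_const_seq iter_muln_1 /primepi /index_iota subn0. Qed.

(** By Legendre's formula and [chebyshev_floor], the exponent of a prime p in
    (30n)! n! exceeds its exponent in (15n)! (10n)! (6n)! by at most the number
    of powers of p up to 30n, that is [trunc_log p (30 * n)]. Each prime up to
    30n therefore contributes a factor of at most 30n to the quotient. *)
Lemma chebyshev_fact n :
  ((30 * n)`! * n`! <=
   (15 * n)`! * (10 * n)`! * (6 * n)`! * (30 * n) ^ primepi (30 * n))%N.
Proof.
have [->|n0] := posnP n; first by [].
set m := (30 * n)%N.
have fm p k : (k <= m)%N -> prime p -> (p %| k`!)%N -> (p <= m)%N.
  by move=> km pp /prime_dvd_fact -/(_ pp) /leq_trans; apply.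
have nm : (n <= m)%N by rewrite /m; lia.
have n15m : (15 * n <= m)%N by rewrite /m; lia.
have n10m : (10 * n <= m)%N by rewrite /m; lia.
have n6m : (6 * n <= m)%N by rewrite /m; lia.
rewrite [leqLHS](@prod_logn _ m) ?muln_gt0 ?fact_gt0 //; last first.
  move=> p pp; rewrite Euclid_dvdM // => /orP[]; exact: fm.
rewrite [X in (_ <= X * _)%N](@prod_logn _ m) ?muln_gt0 ?fact_gt0 //;
  last first.
  move=> p pp; rewrite !Euclid_dvdM // -orbA => /or3P[]; exact: fm.
rewrite -prod_primepi -big_split /=; apply: leq_prod => p pp.
have p1 := prime_gt1 pp.
apply: (@leq_trans (p ^ (logn p ((15 * n)`! * (10 * n)`! * (6 * n)`!)
   + trunc_log p m))); last first.
  by rewrite expnD leq_mul2l trunc_logP ?orbT // /m; lia.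
rewrite leq_exp2l // !lognM ?muln_gt0 ?fact_gt0 //.
rewrite !(@logn_fact_widen _ _ m) // -!big_split /=.
apply: (@leq_trans (\sum_(1 <= k < m.+1)
  (15 * n %/ p ^ k + 10 * n %/ p ^ k + 6 * n %/ p ^ k + (p ^ k <= m)))).
  by apply: leq_sum => k _; apply: chebyshev_floor; rewrite expn_gt0 ltnW.
rewrite big_split leq_add2l /=.
have tm : (trunc_log p m <= m)%N.
  apply: leq_trans (trunc_logP p1 _); last by rewrite /m; lia.
  exact/ltnW/ltn_expl.
rewrite (@big_cat_nat _ _ _ (trunc_log p m).+1) //=.
(* The powers [p ^ k] beyond the truncated logarithm exceed [m]. *)
rewrite [X in (_ + X <= _)%N]big_nat [X in (_ + X <= _)%N]big1 ?addn0 =>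
  [|k /andP[tk _]]; last first.
  by case: leqP => // /(trunc_log_max p1); rewrite leqNgt tk.
apply: (@leq_trans (\sum_(1 <= k < (trunc_log p m).+1) 1)); last first.
  by rewrite sum_nat_const_nat subn1 muln1.
by apply: leq_sum => k _; exact: leq_b1.
Qed.

(** * Chebyshev's lower bound for [primepi] *)

Local Open Scope classical_set_scope.
Local Open Scope ring_scope.

Lemma ln_succ_bounds (R : realType) n : (0 < n)%N ->
  (n.+1%:R^-1 : R) <= ln (n.+1%:R : R) - ln (n%:R : R) <= (n%:R^-1 : R).
Proof.
move=> n0; have n0R : (0 : R) < n%:R by rewrite ltr0n.
have n1R : (0 : R) < n.+1%:R by rewrite ltr0n.
have in0 : (0 : R) < n%:R^-1 by rewrite invr_gt0.
have in1 : (n.+1%:R^-1 : R) < 1 by rewrite invf_lt1 // ltr1n ltnS.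
rewrite -ln_div ?posrE //; apply/andP; split.
- rewrite -[leRHS]opprK -lnV ?posrE ?divr_gt0 // lerNr.
  have -> : ((n.+1%:R / n%:R)^-1 : R) = 1 + (- n.+1%:R^-1).
    by rewrite invf_div -natr1; field; rewrite natr1 !gt_eqF.
  by apply: le_ln1Dx; rewrite ltrN2.
- have -> : (n.+1%:R / n%:R : R) = 1 + n%:R^-1.
    by rewrite -natr1; field; rewrite gt_eqF.
  by apply: le_ln1Dx; lra.
Qed.

Lemma ln_factS (R : realType) n :
  ln (n.+1`!%:R : R) = ln (n.+1%:R : R) + ln (n`!%:R : R).
Proof. by rewrite factS natrM lnM ?posrE ?ltr0n ?fact_gt0. Qed.

(** A form of Stirling's formula that loses only a factor of order n, which is
    enough since only the exponential growth of the quotient matters. Both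
    bounds follow by induction from (1 + 1/n)^n <= e <= (1 + 1/n)^(n+1). *)
Lemma ln_fact_bounds (R : realType) n : (0 < n)%N ->
  (n%:R : R) * ln n%:R - n%:R <= ln (n`!%:R : R)
    <= (n%:R + 1) * ln n%:R - n%:R + 1.
Proof.
elim: n => [//|[_ _|n IH _]]; first by rewrite factS fact0 muln1 !ln1; lra.
have /andP[IH1 IH2] := IH isT.
have /andP[l u] := @ln_succ_bounds R n.+1 isT.
have l' : 1 <= (n.+1%:R + 1) * (ln (n.+2%:R : R) - ln n.+1%:R).
  by rewrite natr1 mulrC -ler_pdivrMr ?ltr0n // div1r.
have u' : n.+1%:R * (ln (n.+2%:R : R) - ln n.+1%:R) <= 1.
  by rewrite mulrC -ler_pdivlMr ?ltr0n // div1r.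
rewrite ln_factS -[n.+2%:R]natr1.
move: IH1 IH2 l' u'; rewrite -[n.+2%:R]natr1.
move: (ln (n.+1%:R + 1)) (ln (n.+1%:R : R)) (ln (n.+1`!%:R : R)) => a b c.
by move: n.+1%:R => N; nra.
Qed.

(** From e^(-1) = (e^(-1/30))^30 >= (1 - 1/30)^30. *)
Lemma expR1_lt (R : realType) : expR 1 < (139 / 50 : R).
Proof.
have h : (29 / 30 : R) ^+ 30 <= expR (-1).
  have -> : (-1 : R) = 30%:R * (- 30^-1) by field.
  rewrite expRM_natl lerXn2r ?nnegrE ?expR_ge0 //.
  by apply: le_trans (expR_ge1Dx _); lra.
have e0 := expR_gt0 (1 : R).
have : (29 / 30 : R) ^+ 30 * expR 1 <= 1.
  by rewrite -[leRHS](expRxMexpNx_1 (1 : R)) mulrC ler_pM2l.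
have : (50 / 139 : R) < (29 / 30) ^+ 30 by lra.
by nra.
Qed.

(** The right-hand side is the logarithm of
    2^14 3^9 5^5 = 30^30 / (15^15 10^10 6^6), the growth rate of Chebyshev's
    quotient; its value is 27.6... The bound combines e^2 < 8, e < 3 and
    e^9 < 10^4, and 105/4 = 30 * 7/8 is what makes 7/8 the final constant. *)
Lemma chebyshev_const (R : realType) :
  105 / 4 <= 14 * ln (2 : R) + 9 * ln (3 : R) + 5 * ln (5 : R).
Proof.
have e := expR1_lt R; have e0 := expR_gt0 (1 : R).
have le_ln (x y : R) : expR x <= y -> x <= ln y.
  move=> xy; rewrite -[leLHS]expRK ler_ln ?posrE ?expR_gt0 //.
  exact: lt_le_trans (expR_gt0 _) xy.
have l2 : 2 <= 3 * ln (2 : R).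
  rewrite mulr_natl -lnXn //; apply: le_ln.
  rewrite (_ : 2 = 2%:R * 1) ?expRM_natl; last by ring.
  by nra.
have l3 : 1 <= ln (3 : R) by apply: le_ln; lra.
have l10 : 9 <= 4 * ln (2 : R) + 4 * ln (5 : R).
  rewrite -mulrDr -lnM ?posrE // mulr_natl -lnXn //; apply: le_ln.
  rewrite (_ : 9 = 9%:R * 1) ?expRM_natl; last by ring.
  apply: (@le_trans _ _ ((139 / 50) ^+ 9)); last by lra.
  by apply: lerXn2r; rewrite ?nnegrE; lra.
lra.
Qed.

(** The logarithm of [chebyshev_fact], with Stirling's bounds for the five
    factorials. The terms n log n and n cancel because 30 + 1 = 15 + 10 + 6; the
    error is log(15n) + log(10n) + log(6n) + 3. *)
Lemma chebyshev_mul30 (R : realType) n : (0 < n)%N ->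
  105 / 4 * n%:R - 3 * ln ((30 * n)%:R : R) - 3 <=
  (primepi (30 * n))%:R * ln ((30 * n)%:R : R).
Proof.
move=> n0; have n0R : (0 : R) < n%:R by rewrite ltr0n.
have kn k : (0 < k)%N -> (0 < k * n)%N by rewrite muln_gt0 n0 andbT.
have F k : 0 < (k`!%:R : R) by rewrite ltr0n fact_gt0.
have H : ln ((30 * n)`!%:R : R) + ln (n`!%:R : R) <=
    ln ((15 * n)`!%:R : R) + ln ((10 * n)`!%:R : R) + ln ((6 * n)`!%:R : R)
    + (primepi (30 * n))%:R * ln ((30 * n)%:R : R).
  have P : (0 : R) < (30 * n)%:R by rewrite ltr0n kn.
  rewrite mulr_natl -lnXn // -!lnM ?posrE ?mulr_gt0 ?exprn_gt0 ?F //.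
  rewrite ler_ln ?posrE ?mulr_gt0 ?exprn_gt0 ?F //.
  by rewrite -natrX -!natrM ler_nat chebyshev_fact.
move: H.
have /andP[] := @ln_fact_bounds R _ n0.
have /andP[] := @ln_fact_bounds R _ (@kn 30%N isT).
have /andP[] := @ln_fact_bounds R _ (@kn 15%N isT).
have /andP[] := @ln_fact_bounds R _ (@kn 10%N isT).
have /andP[] := @ln_fact_bounds R _ (@kn 6%N isT).
have C := chebyshev_const R.
have l2 : 0 <= ln (2 : R) by apply: ln_ge0; lra.
have l3 : 0 <= ln (3 : R) by apply: ln_ge0; lra.
have l5 : 0 <= ln (5 : R) by apply: ln_ge0; lra.
have E30 : ln ((30 * n)%:R : R) = ln 2 + ln 3 + ln 5 + ln n%:R.
  by rewrite natrM lnM ?posrE // (_ : 30 = 2 * 3 * 5) ?lnM ?posrE //; lra.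
have E15 : ln ((15 * n)%:R : R) = ln 3 + ln 5 + ln n%:R.
  by rewrite natrM lnM ?posrE // (_ : 15 = 3 * 5) ?lnM ?posrE //; lra.
have E10 : ln ((10 * n)%:R : R) = ln 2 + ln 5 + ln n%:R.
  by rewrite natrM lnM ?posrE // (_ : 10 = 2 * 5) ?lnM ?posrE //; lra.
have E6 : ln ((6 * n)%:R : R) = ln 2 + ln 3 + ln n%:R.
  by rewrite natrM lnM ?posrE // (_ : 6 = 2 * 3) ?lnM ?posrE //; lra.
rewrite E30 E15 E10 E6 !(natrM _ _ n).
move: (n%:R : R) (ln (n%:R : R)) n0R (ln 2) (ln 3) (ln 5) C l2 l3 l5.
move=> N L N0 a b c C *.
have := ler_wpM2r (ltW N0) C; lra.
Qed.

(** An explicit form of log x = O(x^(1/3)), from e^t >= t^3/6 for t >= 0. *)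
Lemma ln_cube_le (R : realType) (x : R) : 1 <= x -> ln x ^+ 3 <= 6 * x.
Proof.
move=> x1; have x0 : 0 < x by lra.
have := @expR_ge1Dxn R (ln x) 2 (ln_ge0 x1).
by rewrite lnK ?posrE // (_ : 3`!%:R = 6 :> R) //; lra.
Qed.

Lemma ln_nat_near (R : realType) (M : R) :
  \forall n \near \oo, M <= ln (n%:R : R).
Proof.
near=> n; have nM : expR M <= (n%:R : R) by near: n; exact: nbhs_infty_ger.
rewrite -[leLHS]expRK ler_ln ?posrE ?expR_gt0 //.
exact: lt_le_trans (expR_gt0 _) nM.
Unshelve. all: by end_near.
Qed.

(** Apply [chebyshev_mul30] to the largest multiple of 30 below x. The error
    3 log x + O(1) is absorbed by the margin 7/8 - c, since [ln_cube_le] bounds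
    log x by o(x). *)
Lemma chebyshev_lower (R : realType) (c : R) : c < 7 / 8 ->
  \forall x \near \oo, c * x%:R <= (primepi x)%:R * ln (x%:R : R).
Proof.
move=> c78; have d0 : 0 < 7 / 8 - c by lra.
near=> x.
have x30 : (30 <= x)%N by near: x; exact: nbhs_infty_ge.
have t6 : 6 <= ln (x%:R : R) by near: x; exact: ln_nat_near.
have t8 : 8 / (7 / 8 - c) <= ln (x%:R : R) by near: x; exact: ln_nat_near.
have x0 : (0 < x)%N by lia.
have t3 : ln (x%:R : R) ^+ 3 <= 6 * x%:R by apply: ln_cube_le; rewrite ler1n.
have n0 : (0 < x %/ 30)%N by rewrite divn_gt0.
have nx : (30 * (x %/ 30) <= x)%N by lia.
have xn : x%:R <= 30 * (x %/ 30)%:R + 30 :> R.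
  by rewrite -natrM -natrD ler_nat; lia.
have lnx : ln ((30 * (x %/ 30))%:R : R) <= ln (x%:R : R).
  by rewrite ler_ln ?posrE ?ltr0n ?muln_gt0 ?ler_nat.
have ln0 : 0 <= ln ((30 * (x %/ 30))%:R : R).
  by apply: ln_ge0; rewrite ler1n muln_gt0.
have pn : (primepi (30 * (x %/ 30)))%:R <= (primepi x)%:R :> R.
  by rewrite ler_nat leq_primepi.
have main : 105 / 4 * (x %/ 30)%:R - 3 * ln (x%:R : R) - 3
    <= (primepi x)%:R * ln (x%:R : R).
  apply: (@le_trans _ _ ((primepi (30 * (x %/ 30)))%:R
      * ln ((30 * (x %/ 30))%:R : R))); last exact: ler_pM.
  by have := @chebyshev_mul30 R _ n0; lra.
rewrite ler_pdivrMr // in t8.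
(* 30 covers the loss 105/4 from rounding down to a multiple of 30, plus 3. *)
have dx : 3 * ln (x%:R : R) + 30 <= (7 / 8 - c) * x%:R.
  move: t3 t8 t6; move: (ln _) => t; move: (x%:R : R) => X t3 t8 t6.
  have h1 : 48 * t <= (7 / 8 - c) * t ^+ 3.
    apply: (@le_trans _ _ ((t * (7 / 8 - c)) * t ^+ 2)); last by lra.
    by apply: (@le_trans _ _ (8 * t ^+ 2)); [nra | rewrite ler_wpM2r ?sqr_ge0].
  have h2 : (7 / 8 - c) * t ^+ 3 <= (7 / 8 - c) * (6 * X) by rewrite ler_pM2l.
  lra.
lra.
Unshelve. all: by end_near.
Qed.

Lemma primepi_near (N : nat) : \forall x \near \oo, (N <= primepi x)%N.
Proof.
suff [x Nx] : exists x, (N <= primepi x)%N.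
  by exists x => // z /= /leq_primepi; exact: leq_trans.
elim: N => [|N [x Nx]]; first by exists 0%N.
have [[//|p] xp pp] := prime_above x; exists p.+1.
by rewrite primepiS pp addn1 ltnS (leq_trans Nx) // leq_primepi.
Qed.

(** Apply [chebyshev_lower] at x and at y = primepi x; as y <= x, the factor
    log y may be replaced by log x. *)
Lemma chebyshev_lower_iter (R : realType) (c : R) : 0 <= c -> c < 7 / 8 ->
  \forall x \near \oo,
    c ^+ 2 * x%:R <= (primepi (primepi x))%:R * ln (x%:R : R) ^+ 2.
Proof.
move=> c0 c78; have [N _ cheb] := @chebyshev_lower R c c78.
near=> x.
have hx : c * x%:R <= (primepi x)%:R * ln (x%:R : R).
  by near: x; exact: chebyshev_lower.
have Ny : (maxn N 1 <= primepi x)%N by near: x; exact: primepi_near.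
move: Ny hx (primepi_leq x); set y := primepi x.
rewrite geq_max => /andP[Ny y0] hx yx.
have hy : c * y%:R <= (primepi y)%:R * ln (y%:R : R) by apply: cheb; exact: Ny.
have lnx0 : 0 <= ln (x%:R : R) by apply: ln_ge0; rewrite ler1n (leq_trans y0).
have lnyx : ln (y%:R : R) <= ln x%:R.
  by rewrite ler_ln ?posrE ?ltr0n ?ler_nat ?(leq_trans y0).
rewrite expr2 -mulrA; apply: (le_trans (ler_wpM2l c0 hx)).
rewrite mulrA expr2 mulrA ler_wpM2r //; apply: (le_trans hy).
by rewrite ler_wpM2l.
Unshelve. all: by end_near.
Qed.

(** * The singular series *)

(** The partial products decrease, so the limit is at most the product of the
    factors for p = 3 and p = 5, that is 3/4 * 15/16. *)
Lemma singular_series_le (R : realType) : singular_series R <= 45 / 64.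
Proof.
have factor (p : nat) : prime p && (2 < p)%N ->
    0 <= (1 - 1 / (p%:R - 1) ^+ 2 : R) <= 1.
  move=> /andP[_ p2]; have p3 : (3 : R) <= p%:R by rewrite ler_nat.
  have q0 : (1 : R) <= (p%:R - 1) ^+ 2 by nra.
  have q1 : 1 / (p%:R - 1) ^+ 2 <= (1 : R) by rewrite ler_pdivrMr; lra.
  have q2 : 0 <= 1 / (p%:R - 1) ^+ 2 :> R by apply: divr_ge0; lra.
  by apply/andP; split; lra.
pose u n : R :=
  \prod_(0 <= p < n | prime p && (2 < p)%N) (1 - 1 / (p%:R - 1) ^+ 2).
have u0 n : 0 <= u n by apply: prodr_ge0 => p /factor /andP[].
have uS n : u n.+1 <= u n.
  rewrite /u big_mkcond big_nat_recr //= -big_mkcond /= -/(u n).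
  case: ifP => [/factor /andP[_ f1]|_]; last by rewrite mulr1.
  by rewrite ler_piMr.
have udec : nonincreasing_seq u by apply/nonincreasing_seqP.
have ucvg : cvgn u.
  by apply: nonincreasing_is_cvgn => //; exists 0 => _ [n _ <-].
apply: (le_trans (nonincreasing_cvgn_ge udec ucvg 6)).
rewrite /u big_mkcond /= !big_nat_recr //= big_geq //= !mul1r.
by rewrite le_eqVlt; apply/orP; left; apply/eqP; field.
Qed.

(** * Comparison of the two estimates *)

Lemma bounded_of_finite (S : set nat) :
  finite_set S -> exists B, forall n, S n -> (n <= B)%N.
Proof.
move=> /finite_seqP[s ->]; exists (\max_(i <- s) i)%N => n /= ns.
exact: leq_bigmax_seq.
Qed.

(** Here W stands for V(n), D for the O(1) term and S for the singular series.
    Put x = 4n and t = log x. Once log n is large, W t^2 is at most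
    45/64 * 1.01 * 1.004^2 * x < 0.716 x, where 1.01 bounds 1 + e and 1.004
    bounds t / log n, while D t^2 <= 0.03 x. Their sum is below
    0.87^2 x = 0.7569 x. *)
Lemma count_estimates_incompatible (R : realType) (n W D : nat) (S e : R) :
  (0 < n)%N -> 500 <= ln (n%:R : R) -> 200 * D%:R <= ln (n%:R : R) ->
  S <= 45 / 64 -> `|e| <= 1 / 100 ->
  W%:R = 4 * S * (n%:R / ln (n%:R : R) ^+ 2) * (1 + e) ->
  (87 / 100) ^+ 2 * (4 * n)%:R <= (W%:R + D%:R) * ln ((4 * n)%:R : R) ^+ 2 ->
  False.
Proof.
move=> n0; have nR : (1 : R) <= n%:R by rewrite ler1n.
have W0 : (0 : R) <= W%:R by [].
have D0 : (0 : R) <= D%:R by [].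
rewrite natrM.
move: (n%:R : R) (W%:R : R) (D%:R : R) nR W0 D0.
move=> {n0 n W D} x W D x1 W0 D0; set l := ln x; set t := ln (4 * x).
move=> l500 lD S45 eb WE low.
have /andP[lt tl] : l <= t <= l + 2.
  have ln2_ge0 : 0 <= ln (2 : R) by apply: ln_ge0; lra.
  have ln2_le1 : ln (2 : R) <= 1.
    have -> : (2 : R) = 1 + 1 by ring.
    by apply: le_ln1Dx; lra.
  have -> : t = ln 2 + ln 2 + l.
    by rewrite /t (_ : 4 * x = 2 * 2 * x) ?lnM ?posrE //; lra.
  lra.
have t3 : t ^+ 3 <= 6 * (4 * x) by apply: ln_cube_le; lra.
(* 0.7102 is 45/64 * 1.01 rounded up. *)
have Wl : W * l ^+ 2 <= 7102 / 10000 * (4 * x).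
  have l0 : l != 0 by rewrite gt_eqF //; lra.
  have e1 : -1 / 100 <= e <= 1 / 100 by move: eb; rewrite ler_norml; lra.
  have -> : W * l ^+ 2 = (4 * x) * (S * (1 + e)) by rewrite WE; field.
  rewrite mulrC ler_pM2r; last by lra.
  apply: (@le_trans _ _ (45 / 64 * (1 + e))); last by lra.
  by apply: ler_wpM2r => //; lra.
have tt : t ^+ 2 <= (1004 / 1000 * l) ^+ 2.
  by apply: lerXn2r; rewrite ?nnegrE; lra.
have Wt := ler_wpM2l W0 tt.
have Dt : 200 * D * t ^+ 2 <= 6 * (4 * x).
  by apply: le_trans t3; rewrite [leRHS]exprS ler_wpM2r ?sqr_ge0 //; lra.
lra.
Qed.

Theorem theorem1p2 (R : realType)
  (hV : exists2 e : nat -> R,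
     e @ \oo --> (0 : R) &
     \forall N \near \oo,
       (V N)%:R =
         4 * singular_series R * (N%:R / ln (N%:R : R) ^+ 2) * (1 + e N)) :
  infinite_set (A4 `&` [set p : nat | prime p]).
Proof.
move=> /bounded_of_finite[B hB].
have [e e0 eV] := hV.
set C := maxn B 2.
have VC n : (primepi (primepi (4 * n)) <= V n + C)%N.
  apply: leq_trans (@primepi_primepi_le B _ n) _.
    by move=> q Aq pq; exact: hB.
  by rewrite leq_add2r; case: n => // n; rewrite VS leq_addr.
have c0 : (0 : R) <= 87 / 100 by lra.
have c78 : (87 / 100 : R) < 7 / 8 by lra.
have [N0 _ cheb] := @chebyshev_lower_iter R _ c0 c78.
suff : \forall n \near \oo, False by case=> n _ /(_ n (leqnn n)).
near=> n.
apply: (@count_estimates_incompatible R n (V n) C (singular_series R) (e n)).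
- by near: n; exact: nbhs_infty_gt.
- by near: n; exact: ln_nat_near.
- by near: n; exact: ln_nat_near.
- exact: singular_series_le.
- near: n; have h : (0 : R) < 1 / 100 by lra.
  by move/cvgr0Pnorm_le : e0 => /(_ _ h).
- by near: n.
- have nN0 : (N0 <= n)%N by near: n; exact: nbhs_infty_ge.
  apply: (le_trans (cheb (4 * n)%N _)); first exact: leq_trans (leq_pmull _ _).
  by rewrite ler_wpM2r ?sqr_ge0 // -natrD ler_nat.
Unshelve. all: by end_near.
Qed.
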